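(* Let $k$ be a field and let $$0\to C_*\xrightarrow{\iota} D_*\xrightarrow{\kappa} E_*\to 0$$ be a short nearly exact sequence of positively graded chain complexes of $k$-vector spaces. Let $I$ and $K$ be the maps induced in homology by $\iota$ and $\kappa$ respectively. a) If $H_*(\mathrm{Ker}\,\kappa/\mathrm{Im}\,\iota)=0$ for $*\gg 0$, then there is a long exact sequence $$\cdots\xrightarrow{\delta}H_m(C_* )\xrightarrow{I}H_m(D_* )\xrightarrow{K}H_m(E_* )\xrightarrow{\delta}H_{m-1}(C_* )\xrightarrow{I}\cdots\xrightarrow{\delta}H_n(C_* )\xrightarrow{I}H_n(D_* )\xrightarrow{K}H_n(E_* )$$ ending at some $n$. b) If $\dim_k(\mathrm{Ker}\,K/\mathrm{Im}\,I)_*=\dim_k H_*(\mathrm{Ker}\,\kappa/\mathrm{Im}\,\iota)$ for $*\gg 0$, then a sequence of the same form $$\cdots\xrightarrow{\delta}H_m(C_* )\xrightarrow{I}H_m(D_* )\xrightarrow{K}H_m(E_* )\xrightarrow{\delta}H_{m-1}(C_* )\xrightarrow{I}\cdots\xrightarrow{\delta}H_n(C_* )\xrightarrow{I}H_n(D_* )\xrightarrow{K}H_n(E_* )$$ ending at some $n$ exists, and it is a long nearly exact sequence.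
   Context: A sequence of positively graded chain complexes of vector spaces $0\to C_*\xrightarrow{\iota}D_*\xrightarrow{\kappa}E_*\to0$ (with $\iota,\kappa$ chain maps) is short nearly exact if $\iota$ is injective, $\kappa$ is surjective and $\kappa\iota=0$. The quotient complex $(\mathrm{Ker}\,\kappa/\mathrm{Im}\,\iota)_*$ is called the gap complex. ''For $*\gg0$'' means in all sufficiently large degrees. A long nearly exact sequence is a complex of vector spaces $$\cdots\xrightarrow{\delta}U_m\xrightarrow{I}V_m\xrightarrow{K}W_m\xrightarrow{\delta}U_{m-1}\xrightarrow{I}V_{m-1}\to\cdots\xrightarrow{\delta}U_n\xrightarrow{I}V_n\xrightarrow{K}W_n$$ ending at some $n$ which is exact at $W_m$ for all $m>n$ and at all $U_m$ (exactness at the $V_m$ is not required). A long exact sequence ending at $n$ is one of this form that is exact at all $U_m$, all $V_m$, and at $W_m$ for $m>n$.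
   Formalization: In b) the equality of dimensions of Ker K/Im I and of the homology of the gap complex is taken as an equality of finite dimensions in all large degrees; with equal infinite dimensions the claim fails. *)

(* Defs.v *)
From HB Require Import structures.
From mathcomp Require Import all_boot all_order all_algebra.
From mathcomp Require Import boolp.
Set Implicit Arguments.
Unset Strict Implicit.
Unset Printing Implicit Defensive.
Import GRing.Theory.
Local Open Scope ring_scope.
Local Open Scope quotient_scope.

Section KerModIm.
Variables (k : fieldType) (U V W : lmodType k).
Variables (g : {linear U -> V}) (f : {linear V -> W}).

Definition ker_pred : {pred V} := fun x => f x == 0.

Fact ker_pred_submod_closed : submod_closed ker_pred.
Proof.
split=> [|a x y /eqP fx /eqP fy]; apply/eqP; first exact: linear0.
by rewrite linearP fx fy scaler0 addr0.
Qed.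

HB.instance Definition _ :=
  GRing.isSubmodClosed.Build k V ker_pred ker_pred_submod_closed.

Record ker := Ker { ker_val : V; kerP : ker_val \in ker_pred }.
HB.instance Definition _ := [isSub for ker_val].
HB.instance Definition _ := [Choice of ker by <:].
HB.instance Definition _ := [SubChoice_isSubLmodule of ker by <:].

Definition im_pred : {pred ker} := fun z => `[< exists u, g u = val z >].

Fact im_pred_submod_closed : submod_closed im_pred.
Proof.
split=> [|a x y /asboolP[u gu] /asboolP[v gv]]; apply/asboolP.
  by exists 0; rewrite linear0.
by exists (a *: u + v); rewrite linearP gu gv.
Qed.

HB.instance Definition _ :=
  GRing.isSubmodClosed.Build k ker im_pred im_pred_submod_closed.

(* The quotient Ker f / (Im g :&: Ker f), which is Ker f / Im g as soon as    *)
(* f \o g = 0; this holds wherever the construction is used below.            *)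
Definition ker_mod_im := Quotient.quot im_pred.

HB.instance Definition _ := GRing.Zmodule.on ker_mod_im.

Definition ker_mod_im_pi (z : ker) : ker_mod_im := \pi_(Quotient.quot im_pred) z.

Lemma ker_mod_im_piP z t :
  reflect (exists u, g u = val z - val t) (ker_mod_im_pi z == ker_mod_im_pi t).
Proof.
rewrite /ker_mod_im_pi -Quotient.idealrBE.
by apply: (iffP (asboolP _)) => -[u gu]; exists u; rewrite gu linearB.
Qed.

Lemma ker_mod_im_reprK (q : ker_mod_im) :
  ker_mod_im_pi (repr (q : Quotient.quot im_pred)) = q.
Proof. exact: reprK. Qed.

Fact ker_mod_im_pi_is_zmod_morphism : zmod_morphism ker_mod_im_pi.
Proof. by move=> x y; rewrite /ker_mod_im_pi raddfB. Qed.

HB.instance Definition _ := GRing.isZmodMorphism.Build ker ker_mod_im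
  ker_mod_im_pi ker_mod_im_pi_is_zmod_morphism.

Definition ker_mod_im_scale (a : k) (q : ker_mod_im) : ker_mod_im :=
  ker_mod_im_pi (a *: repr (q : Quotient.quot im_pred)).

Lemma ker_mod_im_scaleE a z :
  ker_mod_im_scale a (ker_mod_im_pi z) = ker_mod_im_pi (a *: z).
Proof.
have /eqP/ker_mod_im_piP[u gu] := ker_mod_im_reprK (ker_mod_im_pi z).
apply/eqP/ker_mod_im_piP; exists (a *: u).
by rewrite linearZ gu /= scalerBr.
Qed.

Fact ker_mod_im_scaleA a b q :
  ker_mod_im_scale a (ker_mod_im_scale b q) = ker_mod_im_scale (a * b) q.
Proof. by rewrite -[q]ker_mod_im_reprK !ker_mod_im_scaleE scalerA. Qed.

Fact ker_mod_im_scale1 : left_id 1 ker_mod_im_scale.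
Proof. by move=> q; rewrite -[q]ker_mod_im_reprK ker_mod_im_scaleE scale1r. Qed.

Fact ker_mod_im_scaleDr : right_distributive ker_mod_im_scale +%R.
Proof.
move=> a q r; rewrite -[q]ker_mod_im_reprK -[r]ker_mod_im_reprK.
by rewrite -raddfD !ker_mod_im_scaleE -raddfD scalerDr.
Qed.

Fact ker_mod_im_scaleDl q : {morph ker_mod_im_scale^~ q : a b / a + b}.
Proof.
move=> a b /=; rewrite -[q]ker_mod_im_reprK.
by rewrite !ker_mod_im_scaleE -raddfD scalerDl.
Qed.

HB.instance Definition _ := GRing.Zmodule_isLmodule.Build k ker_mod_im
  ker_mod_im_scaleA ker_mod_im_scale1 ker_mod_im_scaleDr ker_mod_im_scaleDl.

Fact ker_mod_im_pi_is_scalable : scalable ker_mod_im_pi.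
Proof. by move=> a z; rewrite -ker_mod_im_scaleE. Qed.

HB.instance Definition _ := GRing.isScalable.Build k ker ker_mod_im *:%R
  ker_mod_im_pi ker_mod_im_pi_is_scalable.

End KerModIm.

Section KerModImMap.
Variables (k : fieldType) (U V W U' V' W' : lmodType k).
Variables (g : {linear U -> V}) (f : {linear V -> W}).
Variables (g' : {linear U' -> V'}) (f' : {linear V' -> W'}).
Variable a : {linear V -> V'}.
Hypothesis ker_a : forall x, f x = 0 -> f' (a x) = 0.
Hypothesis im_a : forall u, exists u', g' u' = a (g u).

Fact ker_map_proof (z : ker f) : a (val z) \in ker_pred f'.
Proof. exact/eqP/ker_a/eqP/(valP z). Qed.

Definition ker_map (z : ker f) : ker f' := Ker (ker_map_proof z).

Definition ker_mod_im_fun (q : ker_mod_im g f) : ker_mod_im g' f' :=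
  ker_mod_im_pi g' (ker_map (repr (q : Quotient.quot (im_pred g (f := f))))).

Lemma ker_mod_im_funE z :
  ker_mod_im_fun (ker_mod_im_pi g z) = ker_mod_im_pi g' (ker_map z).
Proof.
have /eqP/ker_mod_im_piP[u gu] := ker_mod_im_reprK (ker_mod_im_pi g z).
apply/eqP/ker_mod_im_piP; have [u' gu'] := im_a u.
by exists u'; rewrite gu' gu linearB.
Qed.

Fact ker_mod_im_fun_is_linear : linear ker_mod_im_fun.
Proof.
move=> c q r; rewrite -[q]ker_mod_im_reprK -[r]ker_mod_im_reprK.
rewrite -linearP !ker_mod_im_funE -linearP; congr ker_mod_im_pi.
by apply: val_inj; rewrite /= !linearP.
Qed.

HB.instance Definition _ := GRing.isLinear.Build k
  (ker_mod_im g f) (ker_mod_im g' f') *:%R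
  ker_mod_im_fun ker_mod_im_fun_is_linear.

Definition ker_mod_im_map : {linear ker_mod_im g f -> ker_mod_im g' f'} :=
  ker_mod_im_fun.

Lemma ker_mod_im_mapE z :
  ker_mod_im_map (ker_mod_im_pi g z) = ker_mod_im_pi g' (ker_map z).
Proof. exact: ker_mod_im_funE. Qed.

End KerModImMap.

Section Complexes.
Variable k : fieldType.

Record chain_complex := ChainComplex {
  cmod :> nat -> lmodType k;
  cdiff : forall m, {linear cmod m.+1 -> cmod m};
  cdiffK : forall m x, cdiff m (cdiff m.+1 x) = 0 }.

(* The differential out of degree m, which is zero in degree 0. *)
Definition cdiff_from (C : chain_complex) m : {linear C m -> C m.-1} :=
  match m return {linear C m -> C m.-1} with
  | 0 => (\0 : {linear C 0 -> C 0})
  | m'.+1 => cdiff C m'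
  end.

Definition homology (C : chain_complex) m : lmodType k :=
  ker_mod_im (cdiff C m) (cdiff_from C m).

Record chain_map (C D : chain_complex) := ChainMap {
  cmap :> forall m, {linear C m -> D m};
  cmap_diff : forall m x, cmap m (cdiff C m x) = cdiff D m (cmap m.+1 x) }.

Section Induced.
Variables (C D : chain_complex) (phi : chain_map C D) (m : nat).

Fact homology_map_ker x :
  cdiff_from C m x = 0 -> cdiff_from D m (phi m x) = 0.
Proof.
by case: m x => [|m'] x //= dx; rewrite -cmap_diff dx linear0.
Qed.

Fact homology_map_im u : exists v, cdiff D m v = phi m (cdiff C m u).
Proof. by exists (phi m.+1 u); rewrite cmap_diff. Qed.

Definition homology_map : {linear homology C m -> homology D m} :=
  ker_mod_im_map homology_map_ker homology_map_im.

End Induced.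

Section Gap.
Variables (C D E : chain_complex).
Variables (iota : chain_map C D) (kappa : chain_map D E).

Definition short_nearly_exact : Prop :=
  [/\ forall m, injective (iota m),
      forall m (z : E m), exists y, kappa m y = z
    & forall m x, kappa m (iota m x) = 0].

Definition gap_mod m : lmodType k := ker_mod_im (iota m) (kappa m).

Fact gap_diff_ker m x :
  kappa m.+1 x = 0 -> kappa m (cdiff D m x) = 0.
Proof. by move=> kx; rewrite cmap_diff kx linear0. Qed.

Fact gap_diff_im m u : exists v, iota m v = cdiff D m (iota m.+1 u).
Proof. by exists (cdiff C m u); rewrite cmap_diff. Qed.

Definition gap_diff m : {linear gap_mod m.+1 -> gap_mod m} :=
  ker_mod_im_map (@gap_diff_ker m) (@gap_diff_im m).

Fact gap_diffK m x : gap_diff m (gap_diff m.+1 x) = 0.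
Proof.
rewrite -[x]ker_mod_im_reprK !ker_mod_im_mapE.
rewrite -[RHS](linear0 (@ker_mod_im_pi _ _ _ _ _ _)).
by congr ker_mod_im_pi; apply: val_inj; rewrite /= cdiffK.
Qed.

Definition gap_complex : chain_complex := ChainComplex gap_diffK.

End Gap.

Section LongSequences.

Definition complex_at (U V W : lmodType k)
    (f : {linear U -> V}) (g : {linear V -> W}) : Prop :=
  forall u, g (f u) = 0.

Definition exact_at (U V W : lmodType k)
    (f : {linear U -> V}) (g : {linear V -> W}) : Prop :=
  forall v, g v = 0 <-> exists u, f u = v.

Variables (U V W : nat -> lmodType k).
Variables (I : forall m, {linear U m -> V m}).
Variables (K : forall m, {linear V m -> W m}).
Variables (delta : forall m, {linear W m.+1 -> U m}).
Variable n : nat.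

(* Only the part of the sequence in degrees m >= n is constrained: it stops   *)
(* at K : V n -> W n, and the values of delta m for m < n are irrelevant.     *)
(* The two exactness conditions contain I \o delta = 0 and delta \o K = 0.    *)
Definition long_nearly_exact : Prop := forall m, (n <= m)%N ->
  [/\ exact_at (delta m) (I m),
      complex_at (I m) (K m)
    & exact_at (K m.+1) (delta m)].

Definition long_exact : Prop := forall m, (n <= m)%N ->
  [/\ exact_at (delta m) (I m),
      exact_at (I m) (K m)
    & exact_at (K m.+1) (delta m)].

End LongSequences.

Definition has_dim (V : lmodType k) (d : nat) : Prop :=
  inhabited (Vector.axiom d V).

(* Equality of finite dimensions. With equality of infinite cardinals instead,*)
(* an infinite-dimensional summand D with C = E = 0 and zero differential     *)
(* makes Ker K / Im I and the homology of the gap complex equidimensional for *)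
(* every short nearly exact sequence of countable dimension, without          *)
(* affecting Ker I and Coker K; the dimension criterion for long near         *)
(* exactness then fails.                                                      *)
Definition same_dim (V W : lmodType k) : Prop :=
  exists d, has_dim V d /\ has_dim W d.

End Complexes.

(* Main.v *)
(* Write G = Ker kappa / Im iota. The connecting map H_{m+1}(E) -> H_m(Ker     *)
(* kappa) of 0 -> Ker kappa -> D -> E -> 0 has image the kernel of            *)
(* H_m(Ker kappa) -> H_m(D). It lifts uniquely through                        *)
(* H_m(C) -> H_m(Ker kappa), with the required exactness at H_m(C) and        *)
(* H_{m+1}(E), as soon as the latter map is injective with image containing   *)
(* that kernel. This is immediate if H_m(G) = H_{m+1}(G) = 0.                 *)
(* In general, Ker K / Im I is the quotient of the image of                   *)
(* H_m(Ker kappa) -> H_m(G) by the classes of boundaries of D, that is, a     *)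
(* subquotient of H_m(G). Equality of finite dimensions forces H_m(Ker kappa) *)
(* -> H_m(G) to be onto and to vanish on boundaries of D; the first property  *)
(* in degree m+1 gives the injectivity and the second one in degree m the     *)
(* inclusion.                                                                 *)
From HB Require Import structures.
Require Import Defs.
From mathcomp Require Import all_boot all_order all_algebra.
From mathcomp Require Import boolp.
Import GRing.Theory.
Local Open Scope ring_scope.
Set Implicit Arguments.
Unset Strict Implicit.
Unset Printing Implicit Defensive.

(** Maps between subquotients are handled as linear relations given by representatives. The zigzag
    [conn] is total and single-valued under [conn_lift] and [conn_inj], so [linear_rel_fun] makes it
    the connecting map. The relation [defect_gap] is total and injective, so [linear_rel_same_dim]
    makes it onto and single-valued when the dimensions agree. *)

Section LinearRelations.
Variables (k : fieldType) (V W : lmodType k).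

Definition linear_rel (R : V -> W -> Prop) : Prop :=
  forall a v w v' w', R v w -> R v' w' -> R (a *: v + v') (a *: w + w').

Variable R : V -> W -> Prop.
Hypothesis linR : linear_rel R.

Lemma linear_relB v w v' w' : R v w -> R v' w' -> R (v - v') (w - w').
Proof.
move=> r r'; move: (linR (-1) r' r).
by rewrite !scaleN1r ![- _ + _]addrC.
Qed.

Hypothesis totR : forall v, exists w, R v w.

Lemma linear_rel_fun :
  (forall w, R 0 w -> w = 0) ->
  exists f : {linear V -> W}, forall v w, R v w <-> f v = w.
Proof.
move=> funR; pose f v := sval (cid (totR v)).
have fR v : R v (f v) by rewrite /f; case: cid.
have uniqR v w w' : R v w -> R v w' -> w = w'.
  move=> r r'; apply/eqP; rewrite -subr_eq0; apply/eqP/funR.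
  by rewrite -(subrr v); apply: linear_relB.
have linf : linear f by move=> a u v; apply: uniqR (fR _) (linR a (fR u) (fR v)).
pose fl := GRing.isLinear.Build k V W *:%R f linf.
exists (HB.pack_for {linear V -> W} f fl) => v w.
by split=> [|<-]; [exact: uniqR|exact: fR].
Qed.

(* Through lifts of a basis of [V], [R] contains the graph of an injective    *)
(* linear map, which is bijective because the dimensions agree.               *)
Lemma linear_rel_same_dim :
  same_dim V W -> (forall v, R v 0 -> v = 0) ->
  (forall w, exists v, R v w) /\ (forall w, R 0 w -> w = 0).
Proof.
move=> [d [[[fV linV [gV fVK gVK]]] [[fW linW [gW fWK gWK]]]]] injR.
have linear_inverse (X : lmodType k) (f : X -> 'rV[k]_d) (g : 'rV[k]_d -> X) :
    linear f -> cancel f g -> cancel g f -> linear g.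
  by move=> linf fK gK a x y; apply: (can_inj fK); rewrite linf !gK.
have {}linV := linear_inverse _ _ _ linV fVK gVK.
have linW' := linear_inverse _ _ _ linW fWK gWK.
have lin0 (X Y : lmodType k) (g : X -> Y) : linear g -> g 0 = 0.
  by move=> /(_ (-1) 0 0); rewrite !scaleN1r !addNr.
have [b bR] : exists b : 'I_d -> W, forall i, R (gV (delta_mx 0 i)) (b i).
  by exists (fun i => sval (cid (totR (gV (delta_mx 0 i))))) => i; case: cid.
pose A := \matrix_(i < d) fW (b i).
have [w0 r0] := totR 0.
have R00 : R 0 0 by move: (linear_relB r0 r0); rewrite !subrr.
have AR x : R (gV x) (gW (x *m A)).
  have -> : x *m A = \sum_i x 0 i *: fW (b i).
    by rewrite mulmx_sum_row; apply: eq_bigr => i _; rewrite rowK.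
  rewrite {1}[x]row_sum_delta.
  elim/big_rec2: _ => [|i y z _ r]; first by rewrite !lin0.
  rewrite linV linW' fWK; exact: linR.
(* A row in the kernel of [A] gives a vector related to 0, which [injR] forces to vanish. *)
have Aunit : A \in unitmx.
  rewrite -row_free_unit -kermx_eq0; apply/eqP/row_matrixP => i; rewrite row0.
  have := AR (row i (kermx A)); rewrite -row_mul mulmx_ker row0 (lin0 _ _ gW) //.
  by move/injR => g0; rewrite -[LHS]gVK g0 -[X in fV X](lin0 _ _ _ linV) gVK.
have AinvR w : R (gV (fW w *m invmx A)) w.
  by move: (AR (fW w *m invmx A)); rewrite mulmxKV // fWK.
split=> [w|w rw]; first by exists (gV (fW w *m invmx A)).
have /injR g0 : R (gV (fW w *m invmx A)) 0.
  by move: (linear_relB (AinvR w) rw); rewrite subr0 subrr.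
have x0 : fW w *m invmx A = 0.
  by rewrite -[LHS]gVK g0 -[X in fV X](lin0 _ _ _ linV) gVK.
by rewrite -[w]fWK -[fW w](mulmxKV Aunit) x0 mul0mx lin0.
Qed.

End LinearRelations.

(** * Representatives of classes in subquotients *)

Section Representatives.
Variables (k : fieldType) (U V W : lmodType k).
Variables (g : {linear U -> V}) (f : {linear V -> W}).

Definition rep (x : V) (q : ker_mod_im g f) : Prop :=
  exists2 z : ker f, val z = x & ker_mod_im_pi g z = q.

Lemma rep_ker x q : rep x q -> f x = 0.
Proof. by case=> z <- _; exact/eqP/(valP z). Qed.

Lemma rep_of x : f x = 0 -> exists q, rep x q.
Proof.
move=> /eqP fx; pose z := Ker (fx : x \in ker_pred f).
by exists (ker_mod_im_pi g z); exists z.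
Qed.

Lemma rep_surj q : exists x, rep x q.
Proof. by eexists; eexists; last exact: ker_mod_im_reprK. Qed.

Lemma rep_linear : linear_rel rep.
Proof. by move=> a _ _ _ _ [z <- <-] [t <- <-]; exists (a *: z + t); rewrite linearP. Qed.

Lemma rep0 x : rep x 0 <-> f x = 0 /\ exists u, g u = x.
Proof.
split=> [r|[fx [u gu]]].
  split; first exact: rep_ker r.
  case: r => z <-; rewrite -(linear0 (@ker_mod_im_pi _ _ _ _ g f)).
  by move=> /eqP/ker_mod_im_piP[u]; rewrite subr0; exists u.
have [_ [z zx _]] := rep_of fx; exists z => //.
rewrite -(linear0 (@ker_mod_im_pi _ _ _ _ g f)).
by apply/eqP/ker_mod_im_piP; exists u; rewrite subr0 zx.
Qed.

Lemma rep_uniq x q r : rep x q -> rep x r -> q = r.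
Proof. by case=> z <- <- [t /val_inj-> <-]. Qed.

Lemma rep_eq0 x q : rep x q -> (exists u, g u = x) -> q = 0.
Proof. by move=> r u; apply: (rep_uniq r); apply/rep0; split; first exact: rep_ker r. Qed.

End Representatives.

Section RepMap.
Variables (k : fieldType) (U V W U' V' W' : lmodType k).
Variables (g : {linear U -> V}) (f : {linear V -> W}).
Variables (g' : {linear U' -> V'}) (f' : {linear V' -> W'}).
Variable a : {linear V -> V'}.
Hypothesis ker_a : forall x, f x = 0 -> f' (a x) = 0.
Hypothesis im_a : forall u, exists u', g' u' = a (g u).

Lemma rep_map x q :
  rep (g := g) (f := f) x q -> rep (a x) (ker_mod_im_map ker_a im_a q).
Proof.
by case=> z <- <-; exists (ker_map ker_a z); rewrite ?ker_mod_im_mapE.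
Qed.

End RepMap.

(** * Connecting map and homology of the gap complex *)

Section NearlyExact.
Variables (k : fieldType) (C D E : chain_complex k).
Variables (iota : chain_map C D) (kappa : chain_map D E).
Hypothesis Hsne : short_nearly_exact iota kappa.

Local Notation hrep X m := (@rep k _ _ _ (cdiff X m) (cdiff_from X m)).
Local Notation gap := (gap_complex iota kappa).

Lemma iota_inj m : injective (iota m). Proof. by case: Hsne. Qed.

Lemma kappa_surj m z : exists y, kappa m y = z. Proof. by case: Hsne. Qed.

Lemma kappa_iota m x : kappa m (iota m x) = 0. Proof. by case: Hsne. Qed.

Lemma cdiff_fromK (X : chain_complex k) m x : cdiff_from X m (cdiff X m x) = 0.
Proof. by case: m x => //= m x; rewrite cdiffK. Qed.

Lemma iota_cycle m c : cdiff_from D m (iota m c) = 0 -> cdiff_from C m c = 0.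
Proof.
by case: m c => //= m c; rewrite -cmap_diff -(linear0 (iota m)) => /iota_inj.
Qed.

Lemma hrep_map (X Y : chain_complex k) (phi : chain_map X Y) m x q :
  hrep X m x q -> hrep Y m (phi m x) (homology_map phi m q).
Proof. exact: rep_map. Qed.

(* [conn_inj m] and [conn_lift m] say that the map H_m(C) -> H_m(Ker kappa)   *)
(* is injective, resp. that its image contains the kernel of                  *)
(* H_m(Ker kappa) -> H_m(D), which is the image of the connecting map of      *)
(* 0 -> Ker kappa -> D -> E -> 0.                                             *)
Definition conn_inj m := forall (c : C m) (x : D m.+1),
  kappa m.+1 x = 0 -> iota m c = cdiff D m x -> exists c', cdiff C m c' = c.

Definition conn_lift m := forall d : D m.+1, kappa m (cdiff D m d) = 0 ->
  exists x c, kappa m.+1 x = 0 /\ cdiff D m d = cdiff D m x + iota m c.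

Definition conn m (e : homology E m.+1) (c : homology C m) : Prop :=
  exists d c0, [/\ hrep E m.+1 (kappa m.+1 d) e, hrep C m c0 c
                 & iota m c0 = cdiff D m d].

Lemma conn_linear m : linear_rel (@conn m).
Proof.
move=> a e c e' c' [d [c0 [re rc cd]]] [d' [c0' [re' rc' cd']]].
exists (a *: d + d'), (a *: c0 + c0'); split; rewrite ?linearP ?cd ?cd' //.
- exact: rep_linear.
- exact: rep_linear.
Qed.

Lemma conn_total m : conn_lift m -> forall e, exists c, @conn m e c.
Proof.
move=> lift e; have [e0 re] := rep_surj e; have [d de] := kappa_surj e0.
have /lift[x [c0 [kx dx]]] : kappa m (cdiff D m d) = 0.
  by rewrite cmap_diff de; apply: rep_ker re.
(* Subtracting [x] keeps the image under kappa and moves the boundary into Im iota. *)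
have dc : iota m c0 = cdiff D m (d - x) by rewrite linearB dx addrC addKr.
have /(rep_of (cdiff C m))[c rc] : cdiff_from C m c0 = 0.
  by apply: iota_cycle; rewrite dc cdiff_fromK.
by exists c, (d - x), c0; split; rewrite // linearB kx subr0 de.
Qed.

Lemma conn_functional m : conn_inj m -> forall c, @conn m 0 c -> c = 0.
Proof.
move=> inj c [d [c0 [/rep0[_ [e' de']] rc cd]]]; apply: (rep_eq0 rc).
have [d' d'e] := kappa_surj e'.
apply: (inj c0 (d - cdiff D m.+1 d')); last by rewrite linearB cdiffK subr0.
by rewrite linearB cmap_diff d'e de' subrr.
Qed.

Lemma connecting_map m : conn_inj m -> conn_lift m ->
  exists delta : {linear homology E m.+1 -> homology C m},
    exact_at delta (homology_map iota m) /\
    exact_at (homology_map kappa m.+1) delta.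
Proof.
move=> inj lift.
have [delta deltaP] :=
  linear_rel_fun (@conn_linear m) (conn_total lift) (conn_functional inj).
exists delta; split=> [c|e]; split.
- move=> Ic; have [c0 rc] := rep_surj c.
  have := hrep_map iota rc; rewrite Ic => /rep0[_ [d dc]].
  have /(rep_of (cdiff E m.+1))[e re] : cdiff_from E m.+1 (kappa m.+1 d) = 0.
    by rewrite /= -cmap_diff dc kappa_iota.
  by exists e; apply/deltaP; exists d, c0.
- move=> [e /deltaP[d [c0 [_ rc cd]]]].
  by apply: (rep_eq0 (hrep_map iota rc)); exists d.
- move=> /deltaP[d [c0 [re /rep0[_ [c' dc']] cd]]].
  have /(rep_of (cdiff D m.+1))[h rh] :
      cdiff_from D m.+1 (d - iota m.+1 c') = 0.
    by rewrite linearB /= -cmap_diff dc' cd subrr.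
  exists h; apply: rep_uniq re.
  by have := hrep_map kappa rh; rewrite linearB kappa_iota subr0.
- move=> [h <-]; have [d rd] := rep_surj h.
  apply/deltaP; exists d, 0; split; first exact: hrep_map.
    by apply/rep0; split; [rewrite linear0|exists 0; rewrite linear0].
  by rewrite linear0; have /= -> := rep_ker rd.
Qed.

Lemma connecting_maps N : (forall m, (N <= m)%N -> conn_inj m /\ conn_lift m) ->
  exists delta : forall m, {linear homology E m.+1 -> homology C m},
  forall m, (N <= m)%N -> exact_at (delta m) (homology_map iota m) /\
    exact_at (homology_map kappa m.+1) (delta m).
Proof.
move=> H; have delta m : exists d : {linear homology E m.+1 -> homology C m},
    (N <= m)%N -> exact_at d (homology_map iota m) /\
    exact_at (homology_map kappa m.+1) d.
  (* Below [N] nothing is required, and the zero map is a default. *)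
  have [/H[inj lift]|_] := boolP (N <= m)%N; last by exists \0.
  by have [d] := connecting_map inj lift; exists d.
by exists (fun m => sval (cid (delta m))) => m; case: cid.
Qed.

Lemma homology_complex_at m : complex_at (homology_map iota m) (homology_map kappa m).
Proof.
move=> c; have [c0 rc] := rep_surj c.
apply: (rep_eq0 (hrep_map kappa (hrep_map iota rc))).
by exists 0; rewrite kappa_iota linear0.
Qed.

Definition gap_rep m (z : D m) (q : homology gap m) : Prop :=
  exists2 g : gap_mod iota kappa m, rep z g & hrep gap m g q.

Lemma gap_rep_linear m : linear_rel (@gap_rep m).
Proof.
move=> a z q z' q' [g rg rq] [g' rg' rq'].
by exists (a *: g + g'); apply: rep_linear.
Qed.

Lemma gap_rep_diff m z (g : gap_mod iota kappa m.+1) :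
  rep z g -> rep (cdiff D m z) (cdiff gap m g).
Proof. exact: rep_map. Qed.

(** These are the relative cycles of Ker kappa modulo Im iota; in degree 0 the boundary condition is
    void because [cdiff_from] is zero there. *)
Lemma gap_repP m z :
  (exists q : homology gap m, gap_rep z q) <->
  kappa m z = 0 /\ exists u, iota m.-1 u = cdiff_from D m z.
Proof.
split=> [[q [g rg rq]]|[kz zu]].
  split; first exact: rep_ker rg.
  have := rep_ker rq; case: m z g q rg rq => [|m] z g q rg rq /=.
    by exists 0; rewrite linear0.
  by move=> dg; have := gap_rep_diff rg; rewrite /= dg => /rep0[].
have [g rg] := rep_of (iota m) kz.
have /(rep_of (cdiff gap m))[q rq] : cdiff_from gap m g = 0; last by exists q, g.
case: m z kz zu g rg => [//|m] z kz zu g rg.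
exact: rep_eq0 (gap_rep_diff rg) zu.
Qed.

Lemma gap_rep_surj m (q : homology gap m) : exists z, gap_rep z q.
Proof.
have [g rg] := rep_surj q; have [z rz] := rep_surj g.
by exists z, g.
Qed.

Lemma gap_rep00 m : gap_rep 0 (0 : homology gap m).
Proof.
have [z r] := gap_rep_surj (0 : homology gap m).
by have := linear_relB (@gap_rep_linear m) r r; rewrite !subrr.
Qed.

Lemma gap_rep0 m z : gap_rep z (0 : homology gap m) ->
  exists x c, kappa m.+1 x = 0 /\ z = cdiff D m x + iota m c.
Proof.
move=> [g rg /rep0[_ [g' dg']]]; have [x rx] := rep_surj g'.
have := gap_rep_diff rx; rewrite dg' => rdx.
have := linear_relB (@rep_linear _ _ _ _ _ _) rg rdx.
rewrite subrr => /rep0[_ [c cz]].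
exists x, c; split; first exact: rep_ker rx.
by rewrite cz addrC subrK.
Qed.

(** Replacing [x] by [x - z] does not change its boundary and makes it a relative boundary, so up to
    boundaries it lies in Im iota. *)
Lemma gap_cycles_conn_inj m :
  (forall q : homology gap m.+1, exists2 z, cdiff D m z = 0 & gap_rep z q) ->
  conn_inj m.
Proof.
move=> cyc c x kx cx.
have [q rx] : exists q : homology gap m.+1, gap_rep x q.
  by apply/gap_repP; split=> //; exists c.
have [z dz rz] := cyc q.
have := linear_relB (@gap_rep_linear m.+1) rx rz.
rewrite subrr => /gap_rep0[y [c' [_ xz]]].
exists c'; apply: iota_inj; rewrite cmap_diff cx -[x](subrK z) xz !linearD.
by rewrite cdiffK dz add0r addr0.
Qed.

Lemma gap_boundaries_conn_lift m :
  (forall d (q : homology gap m), gap_rep (cdiff D m d) q -> q = 0) ->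
  conn_lift m.
Proof.
move=> bnd d kd.
have [q rq] : exists q : homology gap m, gap_rep (cdiff D m d) q.
  by apply/gap_repP; split=> //; exists 0; rewrite cdiff_fromK linear0.
by apply: gap_rep0; rewrite -(bnd d q).
Qed.

Lemma hrep_ker_kappa m (h : homology D m) :
  homology_map kappa m h = 0 -> exists2 z, kappa m z = 0 & hrep D m z h.
Proof.
move=> Kh; have [d rd] := rep_surj h.
have := hrep_map kappa rd; rewrite Kh => /rep0[_ [e de]].
have [d' d'e] := kappa_surj e.
(* The image of [d] under kappa bounds, so a boundary of D corrects [d] into Ker kappa. *)
exists (d - cdiff D m d'); first by rewrite linearB cmap_diff d'e de subrr.
have r0 : hrep D m (cdiff D m d') 0.
  by apply/rep0; split; [exact: cdiff_fromK|exists d'].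
by have := linear_relB (@rep_linear _ _ _ _ _ _) rd r0; rewrite subr0.
Qed.

Lemma gap_rep0_im m z (h : homology D m) :
  hrep D m z h -> gap_rep z (0 : homology gap m) ->
  exists c, homology_map iota m c = h.
Proof.
move=> rz /gap_rep0[x [c0 [_ zE]]].
have r0 : hrep D m (cdiff D m x) 0.
  by apply/rep0; split; [exact: cdiff_fromK|exists x].
have := linear_relB (@rep_linear _ _ _ _ _ _) rz r0.
rewrite subr0 zE addrC addKr => rc.
have /(rep_of (cdiff C m))[c rc0] := iota_cycle (rep_ker rc).
by exists c; apply: rep_uniq rc; exact: hrep_map.
Qed.

Lemma gap_rep_cycle m z : kappa m z = 0 -> cdiff_from D m z = 0 ->
  exists q : homology gap m, gap_rep z q.
Proof. by move=> kz dz; apply/gap_repP; split=> //; exists 0; rewrite dz linear0. Qed.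

(** * Comparison of Ker K / Im I with the homology of the gap complex *)

Section SameDim.
Variable m : nat.
Local Notation defect := (ker_mod_im (homology_map iota m) (homology_map kappa m)).

(** Without the dimension hypothesis this is only a relation: 0 is related to the classes of all
    boundaries of D lying in Ker kappa. *)
Definition defect_gap (p : defect) (q : homology gap m) : Prop :=
  exists z (h : homology D m), [/\ hrep D m z h, rep h p & gap_rep z q].

Lemma defect_gap_linear : linear_rel defect_gap.
Proof.
move=> a p q p' q' [z [h [rz rp rq]]] [z' [h' [rz' rp' rq']]].
exists (a *: z + z'), (a *: h + h'); split; try exact: rep_linear.
exact: gap_rep_linear.
Qed.

Lemma defect_gap_total p : exists q, defect_gap p q.
Proof.
have [h rp] := rep_surj p; have [z kz rz] := hrep_ker_kappa (rep_ker rp).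
by have [q rq] := gap_rep_cycle kz (rep_ker rz); exists q, z, h.
Qed.

Lemma defect_gap_inj p : defect_gap p 0 -> p = 0.
Proof.
by move=> [z [h [rz rp rq]]]; apply: (rep_eq0 rp); apply: gap_rep0_im rz rq.
Qed.

Hypothesis dimE : same_dim defect (homology gap m).

Lemma same_dim_cycles (q : homology gap m) :
  exists2 z, cdiff_from D m z = 0 & gap_rep z q.
Proof.
have [/(_ q)[p [z [h [rz _ rq]]]] _] :=
  linear_rel_same_dim defect_gap_linear defect_gap_total dimE defect_gap_inj.
by exists z; first exact: rep_ker rz.
Qed.

Lemma same_dim_boundaries d (q : homology gap m) :
  gap_rep (cdiff D m d) q -> q = 0.
Proof.
have [_ inj] :=
  linear_rel_same_dim defect_gap_linear defect_gap_total dimE defect_gap_inj.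
move=> rq; apply: inj; exists (cdiff D m d), 0; split=> //; apply/rep0.
  by split; [exact: cdiff_fromK|exists d].
by split; [|exists 0]; rewrite linear0.
Qed.

End SameDim.

Lemma gap_acyclic_exact m : (forall q : homology gap m, q = 0) ->
  exact_at (homology_map iota m) (homology_map kappa m).
Proof.
move=> gap0 h; split=> [Kh|[c <-]]; last exact: homology_complex_at.
have [z kz rz] := hrep_ker_kappa Kh.
have [q] := gap_rep_cycle kz (rep_ker rz).
by rewrite (gap0 q); apply: gap_rep0_im rz.
Qed.

End NearlyExact.

Theorem theorem3p4 (k : fieldType) (C D E : chain_complex k)
    (iota : chain_map C D) (kappa : chain_map D E)
    (Hsne : short_nearly_exact iota kappa) :
  ((exists N : nat, forall m : nat, (N <= m)%N ->
      forall x : homology (gap_complex iota kappa) m, x = 0) ->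
    exists (n : nat)
      (delta : forall m : nat, {linear homology E m.+1 -> homology C m}),
      long_exact (homology_map iota) (homology_map kappa) delta n) /\
  ((exists N : nat, forall m : nat, (N <= m)%N ->
      same_dim (ker_mod_im (homology_map iota m) (homology_map kappa m))
               (homology (gap_complex iota kappa) m)) ->
    exists (n : nat)
      (delta : forall m : nat, {linear homology E m.+1 -> homology C m}),
      long_nearly_exact (homology_map iota) (homology_map kappa) delta n).
Proof.
split=> [[N gap0]|[N dimE]]; exists N.
- have [m le_Nm|delta deltaP] := @connecting_maps _ _ _ _ _ _ Hsne N.
    split; first apply: gap_cycles_conn_inj => // q.
      (* The gap homology vanishes in degree [m.+1], so the zero cycle represents every class. *)
      exists 0; first exact: linear0.
      by rewrite (gap0 _ (leqW le_Nm) q); exact: gap_rep00.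
    by apply: gap_boundaries_conn_lift => d q _; apply: gap0.
  exists delta => m le_Nm; have [? ?] := deltaP m le_Nm.
  by split=> //; apply: gap_acyclic_exact => //; apply: gap0.
- have [m le_Nm|delta deltaP] := @connecting_maps _ _ _ _ _ _ Hsne N.
    split; first apply: gap_cycles_conn_inj => //.
      exact/same_dim_cycles/dimE/leqW.
    exact/gap_boundaries_conn_lift/same_dim_boundaries/dimE.
  exists delta => m le_Nm; have [? ?] := deltaP m le_Nm.
  by split=> //; exact: homology_complex_at.
Qed.
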